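(* Let $k\geq 3$, $\ell\geq k$, and $n\geq 2\ell$ be fixed integers. Let $G^*=(K_{k-1}\cup E_{\ell-k+1})\vee E_{n-\ell}$. If $G$ is an $n$-vertex $k$-chromatic $\ell$-connected graph and $t\geq \ell$, then \[ i_t(G)\leq i_t(G^* ). \]
   Context: All graphs are finite and simple. An independent set of $G$ is a set of vertices no two of which are adjacent; $i_t(G)$ denotes the number of independent sets of $G$ having exactly $t$ vertices. A graph is $k$-chromatic if its chromatic number is exactly $k$. A graph $G$ is $\ell$-connected if $|V(G)|>\ell$ and any graph obtained by deleting fewer than $\ell$ vertices is connected. $K_m$ and $E_m$ denote the complete and the empty (edgeless) graph on $m$ vertices, $\cup$ denotes disjoint union, and $G_1\vee G_2$ denotes the join: the graph with vertex set $V(G_1)\sqcup V(G_2)$ and edge set $E(G_1)\cup E(G_2)\cup\{xy: x\in V(G_1), y\in V(G_2)\}$. *)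

(* Defs.v *)
From HB Require Import structures.
From mathcomp Require Import all_boot.

Set Implicit Arguments.
Unset Strict Implicit.
Unset Printing Implicit Defensive.

Record sgraph := SGraph {
  vertex :> finType;
  edge : rel vertex;
  edge_sym : symmetric edge;
  edge_irrefl : irreflexive edge
}.

Arguments edge : clear implicits.

Section Constructions.

Variables (m : nat) (G H : sgraph).

Definition complete_rel : rel 'I_m := fun x y => x != y.

Lemma complete_sym : symmetric complete_rel.
Proof. by move=> x y; rewrite /complete_rel eq_sym. Qed.

Lemma complete_irrefl : irreflexive complete_rel.
Proof. by move=> x; rewrite /complete_rel eqxx. Qed.

Definition complete_graph := SGraph complete_sym complete_irrefl.

Definition empty_rel : rel 'I_m := fun _ _ => false.

Lemma empty_sym : symmetric empty_rel. Proof. by []. Qed.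

Lemma empty_irrefl : irreflexive empty_rel. Proof. by []. Qed.

Definition empty_graph := SGraph empty_sym empty_irrefl.

Definition union_rel : rel (G + H)%type := fun u v =>
  match u, v with
  | inl x, inl y => edge G x y
  | inr x, inr y => edge H x y
  | _, _ => false
  end.

Lemma union_sym : symmetric union_rel.
Proof. by case=> x [] y //=; apply: edge_sym. Qed.

Lemma union_irrefl : irreflexive union_rel.
Proof. by case=> x /=; apply: edge_irrefl. Qed.

Definition union_graph := SGraph union_sym union_irrefl.

Definition join_rel : rel (G + H)%type := fun u v =>
  match u, v with
  | inl x, inl y => edge G x y
  | inr x, inr y => edge H x y
  | _, _ => true
  end.

Lemma join_sym : symmetric join_rel.
Proof. by case=> x [] y //=; apply: edge_sym. Qed.

Lemma join_irrefl : irreflexive join_rel.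
Proof. by case=> x /=; apply: edge_irrefl. Qed.

Definition join_graph := SGraph join_sym join_irrefl.

Variable A : {set G}.

Definition induced_rel : rel {x : G | x \in A} :=
  fun x y => edge G (val x) (val y).

Lemma induced_sym : symmetric induced_rel.
Proof. by move=> x y; apply: edge_sym. Qed.

Lemma induced_irrefl : irreflexive induced_rel.
Proof. by move=> x; apply: edge_irrefl. Qed.

Definition induced_graph := SGraph induced_sym induced_irrefl.

End Constructions.

Section Invariants.

Variable G : sgraph.

Definition independent (S : {set G}) : bool :=
  [forall x in S, forall y in S, ~~ edge G x y].

Definition num_indep (t : nat) : nat :=
  #|[set S : {set G} | independent S & #|S| == t]|.

Definition colorable (c : nat) : bool :=
  [exists f : {ffun G -> 'I_c}, forall x, forall y,
     edge G x y ==> (f x != f y)].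

Lemma ex_colorable : exists c, colorable c.
Proof.
exists #|G|; apply/existsP; exists [ffun x => enum_rank x].
apply/forallP=> x; apply/forallP=> y; apply/implyP=> exy.
rewrite !ffunE (inj_eq enum_rank_inj); apply: contraL exy => /eqP ->.
by rewrite edge_irrefl.
Qed.

Definition chromatic_number : nat := ex_minn ex_colorable.

(* The graph with no vertices counts as connected here; this never matters in
   [l_connected], which leaves at least one vertex after every deletion. *)
Definition connected : Prop := forall x y : G, connect (edge G) x y.

End Invariants.

Definition k_chromatic (k : nat) (G : sgraph) : Prop := chromatic_number G = k.

Definition l_connected (l : nat) (G : sgraph) : Prop :=
  l < #|G| /\
  forall S : {set G}, #|S| < l -> connected (induced_graph (~: S)).

Definition Gstar (k l n : nat) : sgraph :=
  join_graph (union_graph (complete_graph (k - 1)) (empty_graph (l - k + 1)))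
             (empty_graph (n - l)).

(* Main.v *)
Require Import Defs.
From HB Require Import structures.
From mathcomp Require Import all_boot.
From mathcomp Require Import zify.

Set Implicit Arguments.
Unset Strict Implicit.
Unset Printing Implicit Defensive.

(** Write N = n - l.  Independent sets of Gstar inside the part of size N
    already number 'C(N, t), so this is the bound to prove.  Connectivity is
    used only through the minimum degree: every vertex is far from (equal or
    non-adjacent to) at most N vertices.  Hence an independent t-set has at
    most N - t one-point extensions, the counts satisfy
    (t + 1) i_(t+1) <= (N - t) i_t, and since binomials satisfy this with
    equality it suffices to treat t = l ([num_indep_step]).

    If some independent set I has N elements, every vertex outside I is joined
    to all of I.  An independent l-set not inside I must then be the whole
    complement of I, and G would be bipartite ([num_indep_le_big_indep]).

    Otherwise sum over vertices: t i_t is the sum of the numbers k(x) of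
    independent t-sets through x, and k(x) is at most
    C = 'C(N.-1, t.-1), which is the value making the sum equal to
    t 'C(N, t) when N vertices attain it and the others contribute nothing.
    Take x0 maximising k, and suppose first that x0 is far from exactly N
    vertices, so that the set O of its neighbours has t = l elements.  Then
    t i_t is at most N k(x0) plus the sum of k(z) over z in O, and the two terms
    compete.  A vertex z of O has large k(z) only if it is far from many of the
    vertices far from x0 ([through_chord], a chord bound for the convex function
    'C(-, t.-1)).  Each such pair (y, z) uses up one of the at most N vertices
    far from y, so y has an additional neighbour among the vertices far from x0,
    which destroys independent sets through x0 and y ([loss_bound], again a chord
    bound).  If x0 has more than l neighbours, the deficit of vertices far from
    x0 is itself a loss of the same kind, and pays for the larger neighbourhood.
    [capped_bound] adds these effects; the outcome is t i_t < t 'C(N, t) + t,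
    which is enough as i_t is an integer.

    The chord in [loss_bound] stops at a cap c on the number of lost vertices.
    For N >= 2t the cap t always applies.  For N < 2t either some y loses two
    vertices, or x0 has more than l neighbours, and then k(x0) is so small
    that (N + t) k(x0) suffices ([two_cap_bound]); or the cap 1 applies. *)

(** * Chords of binomial coefficients *)

(** Convexity in the discrete sense: the slope of [phi] from [b] increases,
    because the average of the first [i] increments is at most any later one. *)
Lemma chord_le (phi : nat -> nat) b c i :
    (forall j k, j <= k -> phi (b + j).+1 + phi (b + k) <= phi (b + k).+1 + phi (b + j)) ->
    i <= c ->
  c * phi (b + i) + i * phi b <= i * phi (b + c) + c * phi b.
Proof.
move=> cvx.
have step k : i <= k -> phi (b + i) + i * phi (b + k) <= phi b + i * phi (b + k).+1.
  elim: i => [|i IH] ik; first by rewrite addn0; lia.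
  by have := IH (ltnW ik); have := cvx _ _ (ltnW ik); rewrite addnS !mulSn; lia.
elim: c => [|c IH] ic; first by have -> : i = 0 by lia.
have [le_ic | lt_ci] := leqP i c; last by have -> : i = c.+1 by lia.
by have := IH le_ic; have := step c le_ic; rewrite addnS !mulSn; lia.
Qed.

Lemma chord_lt (phi : nat -> nat) b c i :
    (forall j k, j < k -> phi (b + j).+1 + phi (b + k) < phi (b + k).+1 + phi (b + j)) ->
    0 < i < c ->
  c * phi (b + i) + i * phi b < i * phi (b + c) + c * phi b.
Proof.
move=> cvx /andP[i_gt0].
have step k : i <= k -> phi (b + i) + i * phi (b + k) < phi b + i * phi (b + k).+1.
  elim: i i_gt0 => [//|[|i] IH] _ ik.
    by have := cvx 0 k ik; rewrite addn0 addn1; lia.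
  by have := IH isT (ltnW ik); have := cvx _ _ ik; rewrite (addnS _ i.+1) !mulSn; lia.
elim: c => [|c IH] ic //.
have [le_ci | lt_ic] := leqP c i.
  have -> : c = i by lia.
  by have := step i (leqnn i); rewrite addnS !mulSn; lia.
by have := IH lt_ic; have := step c (ltnW lt_ic); rewrite addnS !mulSn; lia.
Qed.

(** The truncation by [minn d c] makes the chord from [P - c] to [P] usable for
    every [d]: below [P - c] monotonicity takes over. *)
Lemma bin_chord P u c d : c <= P ->
  c * 'C(P - d, u) + minn d c * ('C(P, u) - 'C(P - c, u)) <= c * 'C(P, u).
Proof.
move=> cP.
have mono a b : a <= b -> 'C(a, u) <= 'C(b, u) by apply: leq_bin2l.
have lecP := mono _ _ (leq_subr c P).
have [dc | cd] := leqP d c; last first.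
  have := mono _ _ (leq_sub2l P (ltnW cd)).
  by rewrite -mulnDr leq_mul2l => ?; apply/orP; right; lia.
case: u mono lecP => [|u] mono lecP; first by rewrite !bin0 subnn; lia.
have := @chord_le (fun m => 'C(m, u.+1)) (P - c) c (c - d) _ (leq_subr _ _).
rewrite addnBA // subnK //.
suff H : forall j k, j <= k ->
    'C((P - c + j).+1, u.+1) + 'C(P - c + k, u.+1) <=
    'C((P - c + k).+1, u.+1) + 'C(P - c + j, u.+1).
  move=> /(_ H); rewrite mulnBr !mulnBl.
  move: (leq_mul dc (leqnn 'C(P, u.+1))) (leq_mul dc (leqnn 'C(P - c, u.+1))).
  move: (leq_mul (leqnn d) lecP); clear; move: (_ * _) (_ * _) (_ * _) (_ * _) (_ * _).
  by lia.
move=> j k jk; rewrite !binS.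
have : 'C(P - c + j, u) <= 'C(P - c + k, u) by rewrite leq_bin2l ?leq_add2l.
by clear; lia.
Qed.

(** Strictness away from the endpoints is what saves the case [t = 3] of the
    final count, in which [cap1_bound] and [double_cap_bound] are equalities. *)
Lemma bin_chord_lt u q j : 0 < u -> 0 < j < q ->
  q * 'C(u.+1 + j, u.+1) < q + ('C(u.+1 + q, u.+1) - 1) * j.
Proof.
move=> u_gt0 jq.
have lt_bin m : u <= m -> 'C(m, u) < 'C(m.+1, u).
  by case: u u_gt0 => // v _ vm; rewrite binS -addn1 leq_add2l bin_gt0 ltnW.
have := @chord_lt (fun m => 'C(m, u.+1)) u.+1 q j _ jq; rewrite binn.
have : 0 < 'C(u.+1 + q, u.+1) by rewrite bin_gt0 leq_addr.
suff H : forall j k, j < k ->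
    'C((u.+1 + j).+1, u.+1) + 'C(u.+1 + k, u.+1) <
    'C((u.+1 + k).+1, u.+1) + 'C(u.+1 + j, u.+1).
  move=> C_gt0 /(_ H); rewrite mulnBl !muln1 mul1n.
  by have := leq_mul C_gt0 (leqnn j); rewrite mul1n; lia.
move=> a b ab; rewrite !(binS _ u).
have : 'C(u.+1 + a, u) < 'C((u.+1 + a).+1, u) by apply: lt_bin; lia.
have : 'C((u.+1 + a).+1, u) <= 'C(u.+1 + b, u) by apply: leq_bin2l; lia.
by clear; lia.
Qed.

Lemma bin_diag_add u q : u.+1 * 'C(u.+1 + q, u.+1) = (u.+1 + q) * 'C(u + q, u).
Proof. by rewrite -mul_bin_diag. Qed.

(** * Numerical inequalities

    With [t = u + 2] and [N = t + q], the numbers ['C(N.-1, t.-1)] and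
    ['C(N - 2, t - 2)] are ['C(u.+1 + q, u.+1)] and ['C(u + q, u)]. *)

(** The exchange rate between loss and gain for the cap [1]; an equality for
    [u = 1]. *)
Lemma cap1_bound u q : 0 < u -> 0 < q ->
  ('C(u.+1 + q, u.+1) - 1) * u.+1 <=
  (u + q + 2) * q * ('C(u + q, u) - 'C(u + q - 1, u)).
Proof.
case: u => // v _ q_gt0.
have -> : v.+1 + q - 1 = v + q by lia.
have -> : 'C(v.+1 + q, v.+1) - 'C(v + q, v.+1) = 'C(v + q, v).
  by rewrite addSn binS addKn.
have := bin_diag_add v q; have := bin_diag_add v.+1 q.
have : 0 < 'C(v + q, v) by rewrite bin_gt0 leq_addr.
case: q q_gt0 => // -[|q] _.
  by rewrite !addn1 !binSn; nia.
case: v => [|v].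
  rewrite !bin0 !bin1; nia.
set X := 'C(_, v.+1); set D := 'C(_, v.+2); set C := 'C(_, v.+3).
move=> X_gt0 eC eD.
have key : (v.+3 + q.+2) * (v.+2 + q.+2) <= v.+2 * ((v.+2 + q.+2 + 2) * q.+2).
  by clear; nia.
rewrite -(leq_pmul2l (isT : 0 < v.+2)).
rewrite (leq_trans (n := v.+2 * (v.+3 * C))) //.
  by rewrite leq_pmul2l // [X in _ <= X]mulnC leq_mul2r leq_subr orbT.
by rewrite eC mulnCA eD !mulnA leq_mul2r -!mulnA key orbT.
Qed.

(** Of the [s] factors of the quotient of the two binomials, all at most [1],
    only the two smallest are kept. *)
Lemma two_factor_bound s a b : a <= b -> 1 < s ->
  'C(s + a, s) * (b.+1 * b.+2) <= 'C(s + b, s) * (a.+1 * a.+2).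
Proof.
case: s => [|[|s]] // ab _.
have two p : s.+2 * s.+1 * 'C(s.+2 + p, s.+2) = p.+1 * p.+2 * 'C(s.+2 + p, s).
  have e1 : s.+2 * 'C(s.+2 + p, s.+2) = p.+1 * 'C(s.+2 + p, s.+1).
    by rewrite mul_bin_left addSnnS addKn.
  have e2 : s.+1 * 'C(s.+2 + p, s.+1) = p.+2 * 'C(s.+2 + p, s).
    by rewrite mul_bin_left !addSnnS addKn.
  by rewrite mulnAC e1 mulnAC -mulnA [_.+1 * (_ * _)]mulnC e2 mulnC mulnA.
have s_gt0 : 0 < s.+2 * s.+1 by [].
rewrite -(leq_pmul2l s_gt0) ![_ * (_ * (_ * _))]mulnA !two.
have : 'C(s.+2 + a, s) <= 'C(s.+2 + b, s) by rewrite leq_bin2l ?leq_add2l.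
move=> /(leq_mul (leqnn (a.+1 * a.+2 * (b.+1 * b.+2)))).
by clear; move: (binomial _ _) (binomial _ _) (a.+1 * a.+2) (b.+1 * b.+2) => *; lia.
Qed.

(** The exchange rate for the cap [t] when [N = 2 t + j]; an equality for
    [t = 3]. *)
Lemma double_cap_bound t j : 2 < t ->
  ('C(t.-1 + (t + j), t.-1) - 1) * (t * t.-1) <=
  (t + (t + j)) * (t + j) * ('C(t - 2 + (t + j), t - 2) - 'C(t - 2 + j, t - 2)).
Proof.
case: t => [|[|t]] //; rewrite !ltnS => t_gt0; rewrite subn2 !PeanoNat.Nat.pred_succ.
have := bin_diag_add t (t.+2 + j).
have : 0 < 'C(t.+1 + (t.+2 + j), t.+1) by rewrite bin_gt0 leq_addr.
case: t t_gt0 => // -[|t] _.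
  rewrite !bin1; nia.
have le_gD : 'C(t.+2 + j, t.+2) <= 'C(t.+2 + (t.+4 + j), t.+2).
  by rewrite leq_bin2l // leq_add2l leq_addl.
have := @two_factor_bound t.+2 j (t.+4 + j) (leq_addl _ _) isT.
move: le_gD.
move: 'C(t.+2 + j, t.+2) 'C(t.+2 + (t.+4 + j), t.+2) 'C(t.+3 + _, _) => g D C.
move=> le_gD two C_gt0 eC.
(* With T = t.+4 and N = 2T + j, T (N - 1) + N j + T = N (T + j). *)
have num : (t.+4 + (t.+4 + j)) * (t.+4 + j) * (j.+1 * j.+2) <=
    ((t.+4 + (t.+4 + j)) * j + t.+4) * ((t.+4 + j).+1 * (t.+4 + j).+2).
  by clear; nia.
have gap : (t.+4 + (t.+4 + j)) * (t.+4 + j) * g <= ((t.+4 + (t.+4 + j)) * j + t.+4) * D.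
  have pos : 0 < (t.+4 + j).+1 * (t.+4 + j).+2 by [].
  rewrite -(leq_pmul2r pos); move: {pos} num two.
  move: (_ * (t.+4 + j)) (_ + t.+4) (_ * _.+2) (_ * _.+2) => X W Y Z XZ gY.
  by have := leq_mul (leqnn X) gY; have := leq_mul XZ (leqnn D); clear; lia.
have -> : (C - 1) * (t.+4 * t.+3) = t.+4 * (t.+3 * C) - t.+4 * t.+3.
  by rewrite mulnBl mul1n mulnC -mulnA.
rewrite eC (leq_trans (leq_subr _ _)) // mulnBr leq_subRL; last first.
  by rewrite leq_mul2l; apply/orP; right.
by rewrite (leq_trans (leq_add gap (leqnn _))) // leq_eqVlt; apply/orP; left; apply/eqP; lia.
Qed.

(** The left factor is the number [N + t] of vertices, times the bound on [k(x0)]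
    when some vertex far from [x0] is far from at most [N - 2] of the vertices
    far from [x0].  The summand [u.+2] on the right is needed for
    [(u, q) = (1, 2)] and [(2, 3)]. *)
Lemma two_cap_bound u q : 0 < u -> 0 < q < u.+2 ->
  (u + q + 2 + u.+2) * ('C(u + q, u.+1) + 'C(u + q - 2, u)) <
  (u + q + 2) * 'C(u.+1 + q, u.+1) + u.+2.
Proof.
move=> u_gt0; case: q => // -[|p] pu.
  have -> : 'C(u + 1 - 2, u) = 0 by rewrite bin_small //; lia.
  by rewrite !addn1 binn binSn; lia.
rewrite (_ : u + p.+2 - 2 = u + p); last by rewrite !addnS !subSS subn0.
have eC := bin_diag_add u p.+2.
have eS : 'C(u.+1 + p.+2, u.+1) = 'C(u + p.+2, u.+1) + 'C(u + p.+2, u)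
  by rewrite addSn binS.
have eD : p.+2 * p.+1 * 'C(u + p.+2, u) = (u + p.+2) * (u + p.+1) * 'C(u + p, u).
  have e1 : p.+2 * 'C(u + p.+2, u) = (u + p.+2) * 'C(u + p.+1, u).
    have := mul_bin_down (u + p.+2) u.
    by rewrite addKn => <-; rewrite addnS.
  have e2 : p.+1 * 'C(u + p.+1, u) = (u + p.+1) * 'C(u + p, u).
    have := mul_bin_down (u + p.+1) u.
    by rewrite addKn => <-; rewrite addnS.
  by rewrite [p.+2 * _]mulnC -mulnA e1 mulnCA e2 mulnA.
have D_gt0 : 0 < 'C(u + p.+2, u) by rewrite bin_gt0 leq_addr.
(* Multiplying by u.+1 * p.+2 * p.+1 turns all binomials into multiples of
   'C(u + p, u); the resulting polynomial inequality has two exceptions. *)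
have [[-> ->] | [[-> ->] | num]] : (u = 1 /\ p = 0) \/ (u = 2 /\ p = 1) \/
    u.+1 * (u + u + p + 6) * (p.+2 * p.+1) + p * ((u + p.+2) * (u + p.+1)) <=
    (u * u + 3 * u) * ((u + p.+2) * (u + p.+1)).
- have [up | lt_up] := leqP u p.+1; last first.
    have [s ->] : exists s, u = p + 2 + s by exists (u - p - 2); lia.
    by right; right; clear; nia.
  have -> : u = p.+1 by lia.
  case: p {pu eC eS eD D_gt0 up} => [|[|p]]; [by left| by right; left |right; right].
  by clear; nia.
- by [].
- by [].
have key : u.+1 * (u + u + p + 6) * 'C(u + p, u) + p * 'C(u + p.+2, u) <=
    (u * u + 3 * u) * 'C(u + p.+2, u).
  have pos : 0 < (u + p.+2) * (u + p.+1) by rewrite !addnS.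
  rewrite -(leq_pmul2r pos); move: {pos} num eD; clear.
  move: 'C(u + p, u) 'C(u + p.+2, u) (_ * (u + p.+1)) (_ * p.+1) => g D Y Z num eD.
  have := leq_mul num (leqnn D); have := congr1 (muln (u.+1 * (u + u + p + 6))) eD.
  by clear; lia.
have := congr1 (muln u.+2) eC.
move: eS key; clear.
move: 'C(_ + p, u) 'C(u + _, u) 'C(u + _, u.+1) 'C(_, _) => g D C1 C eS key eC.
have : u.+1 * ((u + p.+2 + 2 + u.+2) * (C1 + g)) <= u.+1 * ((u + p.+2 + 2) * C).
  by rewrite eS in eC *; lia.
by rewrite leq_pmul2l // => /leq_ltn_trans->; lia.
Qed.

(** * Independent sets through a vertex *)

Lemma card_between (T : finType) (F : {set {set T}}) (P A : {set T}) s :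
    (forall S, S \in F -> [/\ P \subset S, S \subset A & #|S| = s]) ->
  #|F| <= 'C(#|A| - #|P|, s - #|P|).
Proof.
move=> FP; have [->|[S0 /FP[PS0 S0A _]]] := set_0Vmem F; first by rewrite cards0.
have PA := subset_trans PS0 S0A.
have inj : {in F &, injective (fun S => S :\: P)}.
  move=> S1 S2 /FP[P1 _ _] /FP[P2 _ _] eqD.
  by rewrite -(setID S1 P) -(setID S2 P) eqD !(setIidPr _).
rewrite -(card_in_imset inj) -(cardsDS PA) -cards_draws; apply/subset_leq_card.
apply/subsetP => _ /imsetP[S /FP[PS SA <-] ->].
by rewrite inE setSD // cardsDS ?eqxx.
Qed.

Lemma sum_card_containing (T : finType) (F : {set {set T}}) (D : {set T}) :
  \sum_(x in D) #|[set S in F | x \in S]| = \sum_(S in F) #|S :&: D|.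
Proof.
under eq_bigr do rewrite -sum1dep_card.
rewrite (exchange_big_dep (mem F)) /=; last by move=> x S _ /andP[].
apply: eq_bigr => S SF; rewrite -sum1_card; apply: eq_bigl => x.
by rewrite !inE SF andbC.
Qed.

Section FarSets.
Variable G : sgraph.
Implicit Types (x y z : G) (S : {set G}) (t : nat).

(** The closed neighbourhood of [x] in the complement graph. *)
Definition far x := [set y | ~~ edge G x y].
Definition indep_sets t := [set S : {set G} | independent S & #|S| == t].
Definition through x t := [set S in indep_sets t | x \in S].

Lemma farxx x : x \in far x. Proof. by rewrite inE edge_irrefl. Qed.

Lemma independentP S :
  reflect {in S &, forall x y, ~~ edge G x y} (independent S).
Proof.
apply: (iffP forall_inP) => [h x y xS yS | h x xS].
  by have /forall_inP := h x xS; apply.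
by apply/forall_inP => y; apply: h.
Qed.

Lemma independent_sub_far S x : independent S -> x \in S -> S \subset far x.
Proof. by move=> /independentP h xS; apply/subsetP => y yS; rewrite inE h. Qed.

Lemma sum_through t : \sum_x #|through x t| = t * num_indep G t.
Proof.
have := sum_card_containing (indep_sets t) [set: G].
rewrite (eq_bigl xpredT) => [->|x]; last by rewrite inE.
rewrite (eq_bigr (fun=> t)).
  by rewrite sum_nat_const mulnC.
by move=> S; rewrite inE setIT => /andP[_ /eqP].
Qed.

Lemma through_le x t : #|through x t| <= 'C(#|far x|.-1, t.-1).
Proof.
have := @card_between _ (through x t) [set x] (far x) t.
rewrite cards1 !subn1; apply=> S; rewrite !inE sub1set => /andP[/andP[iS /eqP sS] xS].
by rewrite independent_sub_far.
Qed.

Lemma through2_le x y t : x != y ->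
  #|[set S in through x t | y \in S]| <= 'C(#|far x :&: far y| - 2, t - 2).
Proof.
move=> xy.
have := @card_between _ [set S in through x t | y \in S] [set x; y]
  (far x :&: far y) t.
rewrite cards2 xy; apply=> S; rewrite !inE => /andP[/andP[/andP[iS /eqP sS] xS] yS].
by rewrite subUset !sub1set xS yS subsetI !independent_sub_far.
Qed.

Lemma through_le_split x y t : x != y ->
  #|through x t| <= 'C(#|far x :\ y|.-1, t.-1) + 'C(#|far x :&: far y| - 2, t - 2).
Proof.
move=> xy; rewrite -(cardsID [set S : {set G} | y \in S]) addnC leq_add //.
  have := @card_between _ (through x t :\: [set S : {set G} | y \in S])
    [set x] (far x :\ y) t.
  rewrite cards1 !subn1; apply=> S; rewrite !inE sub1set.
  move=> /and3P[yS /andP[iS /eqP sS] xS]; rewrite xS sS; split=> //.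
  by rewrite subsetD1 yS independent_sub_far.
apply: leq_trans (through2_le t xy).
by apply/subset_leq_card/subsetP => S; rewrite !inE => /andP[-> ->].
Qed.

Lemma sum_through2 x t :
  \sum_(y in far x :\ x) #|[set S in through x t | y \in S]| = t.-1 * #|through x t|.
Proof.
rewrite sum_card_containing (eq_bigr (fun=> t.-1)).
  by rewrite sum_nat_const mulnC.
move=> S; rewrite !inE => /andP[/andP[iS /eqP <-] xS].
by rewrite setIDA (setIidPl (independent_sub_far iS xS)) (cardsD1 x S) xS.
Qed.

End FarSets.

(** * Graphs without an independent set of size N *)

Section Bound.
Variables (G : sgraph) (u q : nat).
Local Notation t := u.+2.
Local Notation N := (u.+2 + q).
Local Notation C := 'C(u.+1 + q, u.+1).
Local Notation D := 'C(u + q, u).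
Hypothesis (u_gt0 : 0 < u) (q_gt0 : 0 < q).
Hypothesis far_le : forall x : G, #|far x| <= N.
Hypothesis no_indep : forall S : {set G}, independent S -> #|S| != N.

(** Equality would make [far x] have [N] elements and all its subsets of size [t]
    through [x] independent; a pair of adjacent vertices in it prevents this
    because [t >= 3]. *)
Lemma through_lt (x : G) : #|through x t| < C.
Proof.
have D_gt0 : 0 < D by rewrite bin_gt0 leq_addr.
have eC : C = 'C(u + q, u.+1) + D by rewrite addSn binS.
have := far_le x; rewrite leq_eqVlt => /orP[/eqP eqN | ltN]; last first.
  apply: leq_ltn_trans (through_le x t) _.
  rewrite eC -[X in X < _]addn0 -addnS leq_add // leq_bin2l //.
  by move: ltN; lia.
have : ~~ independent (far x).
  by apply/negP => /no_indep; rewrite eqN eqxx.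
rewrite negb_forall_in => /exists_inP[y yx]; rewrite negb_forall_in.
move=> /exists_inP[z zx]; rewrite negbK => yz.
have xy : x != y by apply: contraTneq yz => <-; move: zx; rewrite inE.
apply: leq_ltn_trans (through_le_split t xy) _.
rewrite eC -addnS leq_add //.
  rewrite leq_bin2l //; have := cardsD1 y (far x); rewrite yx eqN.
  by move=> /(congr1 predn) /=; lia.
rewrite !subn2 /=; have : #|far x :&: far y| - 2 < u + q.
  have : far x :&: far y \subset far x :\ z.
    by rewrite subsetD1 subsetIl !inE yz andbF.
  move=> /subset_leq_card; have := cardsD1 z (far x); rewrite zx eqN; lia.
move=> lt; apply: leq_ltn_trans (leq_bin2l _ (_ : _ <= (u + q).-1)) _;
  first by lia.
case: (u) u_gt0 => // v _.
by rewrite addSn /= [in X in _ < X]binS -addn1 leq_add2l bin_gt0 leq_addr.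
Qed.

(** Pad [far x] to size [N].  Both a padding vertex and a vertex [y] missing
    [N - #|far x :&: far y|] of the others lower the number of independent sets
    through [x] and itself, by at least the slope of the chord per missing vertex
    up to the cap [c]; a padding vertex loses everything. *)
Lemma loss_bound (x : G) c : c <= u + q ->
  c * u.+1 * #|through x t| +
  (D - 'C(u + q - c, u)) *
  (c * (N - #|far x|) + \sum_(y in far x :\ x) minn (N - #|far x :&: far y|) c)
  <= c * u.+1 * C.
Proof.
move=> cP.
have eC := bin_diag_add u q.
have term y : y \in far x :\ x ->
    c * #|[set S in through x t | y \in S]| +
    (D - 'C(u + q - c, u)) * minn (N - #|far x :&: far y|) c <= c * D.
  move=> /setD1P[yx yfar]; apply: leq_trans (bin_chord u (N - #|far x :&: far y|) cP).
  rewrite [_ * minn _ _]mulnC leq_add2r leq_mul2l; apply/orP; right.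
  rewrite eq_sym in yx; apply: leq_trans (through2_le t yx) _; rewrite !subn2 /=.
  apply: leq_bin2l.
  have : [set x; y] \subset far x :&: far y.
    by rewrite subUset !sub1set !inE !edge_irrefl; move: yfar; rewrite inE edge_sym andbT => ->.
  move=> /subset_leq_card; rewrite cards2 yx.
  have := subset_leq_card (subsetIl (far x) (far y)); have := far_le x; lia.
have := leq_sum (index_enum _) term.
rewrite big_split /= -!big_distrr /= sum_through2 sum_nat_const.
have := cardsD1 x (far x); rewrite farxx => eA.
have eN : N - #|far x| + #|far x :\ x| = u.+1 + q by have := far_le x; lia.
move: eC eN; move: (\sum_(y in _) _) #|far x :\ x| (N - #|far x|) => Sm a f eC eN.
have GD : D - 'C(u + q - c, u) <= D by apply: leq_subr.
move: GD eC; move: D C #|through x t| (D - _) => D' C' k Gc GD eC le.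
rewrite -[c * u.+1 * C']mulnA eC -eN.
have := leq_mul (leqnn (c * f)) GD; lia.
Qed.

(** The chord joins the values [1] at [#|far z| = t] and [C] at [#|far z| = N].
    At the upper end strictness comes from [through_lt], in between from
    convexity. *)
Lemma through_chord (z : G) :
  q * #|through z t| + (t < #|far z|) <= q + (C - 1) * (#|far z| - t).
Proof.
have C_gt0 : 0 < C by rewrite bin_gt0 leq_addr.
have le := through_le z t.
case: (ltnP t #|far z|) => [lt_far | le_far]; last first.
  have : 'C(#|far z|.-1, t.-1) <= 'C(u.+1, u.+1) by rewrite leq_bin2l //; lia.
  rewrite binn => le1; rewrite addn0 -[X in _ <= X + _]muln1.
  by rewrite (leq_trans _ (leq_addr _ _)) // leq_mul2l (leq_trans le le1) orbT.
have := far_le z; rewrite leq_eqVlt => /orP[/eqP-> | ltN].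
  rewrite addKn; have : #|through z t| <= C - 1 by have := through_lt z; lia.
  by move=> /(leq_mul (leqnn q)); rewrite [(C - 1) * q]mulnC; lia.
have [j [j_gt0 ej]] : exists j, 0 < j /\ #|far z| = t + j.
  by exists (#|far z| - t); lia.
rewrite ej addKn addn1; apply: leq_trans (bin_chord_lt u_gt0 _).
  by rewrite ltnS leq_mul2l; apply/orP; right; move: le; rewrite ej addSn.
by rewrite j_gt0; lia.
Qed.

(** The set [O] consists of [t] neighbours of [x0], or of all if there are fewer.
    The other neighbours, at most [N - #|far x0|] many, are counted together with
    [far x0], which they complete to at most [N] vertices. *)
Lemma num_indep_le_max (x0 : G) :
    #|G| <= N + t -> (forall x : G, #|through x t| <= #|through x0 t|) ->
  exists O : {set G}, [/\ O \subset ~: far x0, #|O| <= t,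
    forall z : G, z \in O -> #|far z| - t <= (N - #|far x0|) + #|far x0 :&: far z|
    & t * num_indep G t <= N * #|through x0 t| + \sum_(z in O) #|through z t|].
Proof.
move=> cardG max0; have eG := cardsC (far x0).
have [O /andP[OA /eqP cardO]] :
    exists O : {set G}, (O \subset ~: far x0) && (#|O| == minn t #|~: far x0|).
  have : 0 < 'C(#|~: far x0|, minn t #|~: far x0|) by rewrite bin_gt0 geq_minr.
  by rewrite -cards_draws => /card_gt0P[O]; rewrite inE; exists O.
exists O; split => //; first by rewrite cardO geq_minl.
  move=> z zO; have := cardsID (far x0) (far z); rewrite setIC setDE.
  have := subset_leq_card (subsetIr (far z) (~: far x0)).
  by have := far_le x0; lia.
rewrite -sum_through (bigID (mem O)) /= addnC leq_add2r.
apply: leq_trans (leq_sum _ (fun x _ => max0 x)) _; rewrite sum_nat_const leq_mul2r.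
apply/orP; right; rewrite (eq_card (B := ~: O)); last by move=> x; rewrite !inE.
by have := cardsC O; have := far_le x0; lia.
Qed.

(** The numerical hypothesis says that one unit of loss at [x0], counted [N] times,
    outweighs one unit of gain in [O].  The last hypothesis guarantees that the
    cap does not cut off any loss that is forced by a gain. *)
Lemma capped_bound (x0 : G) c :
    #|G| <= N + t -> (forall x : G, #|through x t| <= #|through x0 t|) ->
    0 < c <= u + q ->
    (C - 1) * (c * u.+1) <= N * q * (D - 'C(u + q - c, u)) ->
    c = t \/ #|far x0| = N /\
      {in far x0 :\ x0, forall y, N - #|far x0 :&: far y| <= c} ->
  num_indep G t <= 'C(N, t).
Proof.
move=> cardG max0 /andP[c_gt0 cP] num capped.
have [O [OA cardO farO le]] := num_indep_le_max cardG max0.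
have /(_ _ cP) loss := loss_bound x0.
set Sm := \sum_(y in _) _ in loss.
pose S := \sum_(z in O) (#|far z| - t).
have leS : S <= c * (N - #|far x0|) + Sm.
  (* Double counting of the pairs y far from x0, z in O that are far apart. *)
  have : S <= #|O| * (N - #|far x0|) + \sum_(y in far x0 :\ x0) #|far y :&: O|.
    have -> : \sum_(y in far x0 :\ x0) #|far y :&: O| =
        \sum_(z in O) #|far x0 :&: far z|.
      transitivity (\sum_(z in O) #|[set y in far x0 :\ x0 | z \in far y]|).
        under [RHS]eq_bigr do rewrite -sum1dep_card.
        rewrite (exchange_big_dep (mem (far x0 :\ x0))) /=; last by move=> z y _ /andP[].
        apply: eq_bigr => y yA; rewrite -sum1_card; apply: eq_bigl => z.
        by rewrite in_setI yA /= andbC.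
      apply: eq_bigr => z /(subsetP OA); rewrite inE => zA.
      apply: eq_card => y; rewrite !inE; case: (eqVneq y x0) => [->|_] /=.
        by move: zA; rewrite !inE edge_irrefl /= edge_sym => /negbTE->.
      by rewrite [edge G z y]edge_sym.
    by rewrite -sum_nat_const -big_split; apply: leq_sum => z /farO.
  move=> /leq_trans; apply.
  have dO y : #|far y :&: O| <= N - #|far x0 :&: far y|.
    have : #|far y :&: O| + #|far x0 :&: far y| <= #|far y|.
      rewrite -[X in _ <= X](cardsID (far x0)) addnC [far x0 :&: _]setIC leq_add2l.
      by rewrite subset_leq_card // setDE setIS.
    by have := far_le y; lia.
  case: capped => [ct | [-> capped]]; apply: leq_add.
  - by rewrite ct leq_mul2r cardO orbT.
  - apply: leq_sum => y _; rewrite leq_min dO ct (leq_trans _ cardO) //.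
    exact/subset_leq_card/subsetIr.
  - by rewrite subnn !muln0.
  - by apply: leq_sum => y /capped yc; rewrite (minn_idPl yc).
have tradeoff : N * q * #|through x0 t| + (C - 1) * S <= N * q * C.
  rewrite -(leq_pmul2l (_ : 0 < c * u.+1)) ?muln_gt0 ?c_gt0 //.
  have := leq_mul (leqnn (N * q)) loss; have := leq_mul num leS.
  move: (D - _) (_ + Sm) (S) C #|through x0 t| (N * q) => Gc S' S0 C' k Nq.
  by clear; lia.
have chord : q * \sum_(z in O) #|through z t| + (0 < S) <= q * t + (C - 1) * S.
  have : \sum_(z in O) (q * #|through z t| + (t < #|far z|)) <=
         \sum_(z in O) (q + (C - 1) * (#|far z| - t)).
    by apply: leq_sum => z _; apply: through_chord.
  rewrite !big_split /= -!big_distrr /= sum_nat_const [#|O| * q]mulnC => chord.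
  apply: leq_trans (leq_trans chord _); last by rewrite leq_add2r leq_mul2l cardO orbT.
  rewrite leq_add2l; have [//|S_gt0] := posnP S.
  move: S_gt0; rewrite lt0n sum_nat_eq0 negb_forall => /existsP[z].
  rewrite negb_imply => /andP[zO far_z]; rewrite (bigD1 z) //=.
  by rewrite (_ : t < #|far z|) // -subn_gt0 lt0n.
have : t * num_indep G t < N * C + t.
  apply: leq_ltn_trans le _.
  (* Without any gain the strictness has to come from x0 itself. *)
  have [S0 | S_gt0] := posnP S.
    rewrite S0 muln0 !addn0 leq_pmul2l // in chord.
    by rewrite -addSn leq_add // ltn_pmul2l // through_lt.
  rewrite S_gt0 in chord; rewrite -(ltn_pmul2l q_gt0).
  by move: chord tradeoff; move: N C => n c'; clear; lia.
have -> : N * C = t * 'C(N, t) by rewrite -mul_bin_diag.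
by rewrite -mulnSr ltn_mul2l ltnS.
Qed.

End Bound.

(** * The remaining reductions and the theorem *)

Lemma num_indep_step (G : sgraph) N t :
    (forall x : G, #|far x| <= N) -> 0 < t ->
  t.+1 * num_indep G t.+1 <= (N - t) * num_indep G t.
Proof.
move=> farN t_gt0; rewrite -sum_through.
pose ext (S : {set G}) x := (x \notin S) && independent (x |: S).
have drop x : #|through x t.+1| <= #|[set S in indep_sets G t | ext S x]|.
  have inj : {in through x t.+1 &, injective (fun S => S :\ x)}.
    move=> S T; rewrite !inE => /andP[_ xS] /andP[_ xT] eqST.
    by rewrite -(setD1K xS) eqST setD1K.
  rewrite -(card_in_imset inj); apply/subset_leq_card/subsetP => _ /imsetP[S + ->].
  rewrite !inE => /andP[/andP[iS /eqP sS] xS].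
  rewrite /ext setD1K // iS !inE eqxx /= andbT; apply/andP; split.
    by apply/independentP => y z /setD1P[_ yS] /setD1P[_ zS]; apply: (independentP _ iS).
  by have := cardsD1 x S; rewrite xS sS add1n => -[<-].
apply: leq_trans (leq_sum _ (fun x _ => drop x)) _.
under eq_bigr do rewrite -sum1dep_card.
rewrite (exchange_big_dep (mem (indep_sets G t))) /=; last by move=> x S _ /andP[].
rewrite mulnC -sum_nat_const; apply: leq_sum => S S_ind.
rewrite (eq_bigl (mem [set x | ext S x]));
  last by move=> x; move: S_ind; rewrite /= !inE => ->.
rewrite sum1_card; move: S_ind; rewrite inE => /andP[iS /eqP sS].
have [v vS] : exists v, v \in S by apply/set0Pn; rewrite -card_gt0 sS.
have : [set x | ext S x] \subset far v :\: S.
  apply/subsetP => x; rewrite !inE => /andP[-> /independentP /(_ v x)].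
  by rewrite !inE vS eqxx orbT; apply.
move=> /subset_leq_card /leq_trans; apply.
rewrite cardsDS ?independent_sub_far // sS; exact: leq_sub2r.
Qed.

(** For [N = t] a counted set would be an excluded one; for [N >= 2 t] the cap is
    [t], and otherwise the dichotomy of [two_cap_bound] leaves the cap [1]. *)
Lemma num_indep_le_bin_base (G : sgraph) N t :
    2 < t <= N -> #|G| <= N + t -> (forall x : G, #|far x| <= N) ->
    (forall S : {set G}, independent S -> #|S| != N) ->
  num_indep G t <= 'C(N, t).
Proof.
case: t => [|[|u]] //; rewrite !ltnS => /andP[u_gt0 leN] cardG farN noN.
have [q eN] : exists q, N = u.+2 + q by exists (N - u.+2); rewrite subnKC.
rewrite {leN}eN in cardG farN noN *.
have [S0|] := set_0Vmem (indep_sets G u.+2);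
  first by rewrite /num_indep -/(indep_sets G u.+2) S0 cards0.
case=> S; rewrite inE => /andP[iS /eqP sS].
have [|q_gt0] := posnP q.
  by move=> q0; have := noN _ iS; rewrite sS q0 addn0 eqxx.
have [x1 _] : exists x, x \in S by apply/set0Pn; rewrite -card_gt0 sS.
case: (@arg_maxnP _ x1 predT (fun x => #|through x u.+2|) isT) => x0 _ max0.
have max_x0 (x : G) : #|through x u.+2| <= #|through x0 u.+2| by exact: (max0 x isT).
have [le_tq | lt_qt] := leqP u.+2 q.
  apply: (@capped_bound G u q u_gt0 q_gt0 farN noN x0 u.+2) => //; last by left.
    by rewrite (leq_trans le_tq) ?leq_addl.
  have := @double_cap_bound u.+2 (q - u.+2) u_gt0.
  by rewrite subnKC // !subn2 /= addnBA.
have [le_k0 | gt_k0] := leqP #|through x0 u.+2| ('C(u + q, u.+1) + 'C(u + q - 2, u)).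
  have : u.+2 * num_indep G u.+2 < (u.+2 + q) * 'C(u.+1 + q, u.+1) + u.+2.
    rewrite -sum_through; apply: leq_ltn_trans (leq_sum _ (fun x _ => max_x0 x)) _.
    rewrite sum_nat_const; apply: leq_ltn_trans (leq_mul cardG le_k0) _.
    have := @two_cap_bound u q u_gt0; rewrite q_gt0 lt_qt => /(_ isT).
    by rewrite (_ : u + q + 2 = u.+2 + q) // addn2.
  by rewrite (mul_bin_diag (u.+2 + q) u.+1) -mulnSr ltn_mul2l ltnS.
have full : #|far x0| = u.+2 + q.
  apply/eqP; rewrite eqn_leq farN leqNgt; apply: contraL gt_k0 => lt_far.
  rewrite -leqNgt (leq_trans (through_le _ _)) // (leq_trans _ (leq_addr _ _)) //.
  by apply: leq_bin2l; move: lt_far; case: #|_|.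
apply: (@capped_bound G u q u_gt0 q_gt0 farN noN x0 1) => //; first by rewrite addn_gt0 u_gt0.
  have := cap1_bound u_gt0 q_gt0; rewrite mul1n.
  by rewrite (_ : u + q + 2 = u.+2 + q) // addn2.
right; split=> // y /setD1P[yx0 y_far]; rewrite leqNgt.
apply: contraL gt_k0 => lt1; rewrite -leqNgt eq_sym in yx0 *.
apply: leq_trans (through_le_split _ yx0) _; rewrite !subn2 /= -!subn2.
have := cardsD1 y (far x0); rewrite y_far full => eD.
by apply: leq_add; apply: leq_bin2l; lia.
Qed.

(** A vertex [x] of [I] has [far x = I], so an independent set meeting both [I] and
    its complement is impossible; the complement has exactly [l] vertices. *)
Lemma num_indep_le_big_indep (G : sgraph) N l (I : {set G}) :
    #|G| = N + l -> 0 < N -> (forall x : G, #|far x| <= N) ->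
    independent I -> #|I| = N -> ~~ colorable G 2 ->
  num_indep G l <= 'C(N, l).
Proof.
move=> cardG N_gt0 farN iI sI not_bip.
have farI x : x \in I -> far x = I.
  move=> xI; apply/esym/eqP.
  by rewrite eqEcard independent_sub_far // sI farN.
have [x0 x0I] : exists x, x \in I by apply/set0Pn; rewrite -card_gt0 sI.
rewrite -sI -cards_draws; apply/subset_leq_card/subsetP => S.
rewrite !inE => /andP[iS sS]; rewrite sS andbT.
apply: contraR not_bip => /subsetPn[y yS yI].
have eS : S = ~: I.
  apply/eqP; rewrite eqEcard; apply/andP; split; last first.
    by rewrite (eqP sS); have := cardsC I; lia.
  apply/subsetP => x xS; rewrite inE; apply: contraNN yI => xI.
  by rewrite -(farI x xI) inE (independentP _ iS).
apply/existsP; exists [ffun x => (if x \in I then ord0 else ord_max) : 'I_2].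
apply/forallP => x; apply/forallP => z; apply/implyP; rewrite !ffunE.
case: ifPn => xI; case: ifPn => zI // exz.
  by have := independentP _ iI _ _ xI zI; rewrite exz.
by have := independentP _ iS x z; rewrite eS !inE exz => /(_ xI zI).
Qed.

(** Deleting the neighbours of [x] isolates it, and fewer than [l] neighbours would
    leave another vertex. *)
Lemma card_far_l_connected (G : sgraph) l (x : G) :
  l_connected l G -> #|far x| <= #|G| - l.
Proof.
case=> lt_lG conn; rewrite leqNgt; apply/negP => gt_far.
have few : #|~: far x| < l by have := cardsC (far x); lia.
have [y /setD1P[yx y_far]] : exists y, y \in far x :\ x.
  by apply/set0Pn; rewrite -card_gt0; have := cardsD1 x (far x); rewrite farxx; lia.
have inC z : z \in far x -> z \in ~: ~: far x by rewrite setCK.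
have /connectP[] := conn _ few (exist _ x (inC _ (farxx x))) (exist _ y (inC _ y_far)).
move=> [|z p] /=; first by move=> _ [eq_yx]; rewrite eq_yx eqxx in yx.
case/andP=> + _ _; rewrite /induced_rel /=; have := valP z.
by rewrite !inE negbK => /negbTE->.
Qed.

Lemma num_indep_Gstar_ge k l n t : 'C(n - l, t) <= num_indep (Gstar k l n) t.
Proof.
rewrite -[n - l in X in X <= _]card_ord -cardsT -cards_draws.
pose inc (B : {set 'I_(n - l)}) : {set Gstar k l n} := [set inr x | x in B].
have inc_inj : injective inc by apply: imset_inj => x y [].
rewrite -(card_imset _ inc_inj); apply/subset_leq_card/subsetP => _ /imsetP[B + ->].
rewrite !inE subsetT /= => /eqP sB; rewrite card_imset; last by move=> x y [].
rewrite sB eqxx andbT; apply/independentP.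
by move=> _ _ /imsetP[x _ ->] /imsetP[y _ ->].
Qed.

Theorem theorem1p6 (k l n t : nat) (G : sgraph)
    (hk : 3 <= k) (hl : k <= l) (hn : 2 * l <= n)
    (hcard : #|G| = n) (hchrom : k_chromatic k G) (hconn : l_connected l G)
    (ht : l <= t) :
  num_indep G t <= num_indep (Gstar k l n) t.
Proof.
apply: leq_trans (num_indep_Gstar_ge k l n t).
have far_le (x : G) : #|far x| <= n - l.
  by rewrite -hcard; apply: card_far_l_connected.
rewrite -(subnKC ht); elim: (t - l) => [|d IH]; last first.
  rewrite addnS -(leq_pmul2l (ltn0Sn (l + d))) mul_bin_left.
  apply: leq_trans (num_indep_step far_le _) _; first by lia.
  by rewrite leq_mul2l IH orbT.
rewrite addn0.
have [/existsP[I /andP[iI /eqP sI]] | none] :=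
    boolP [exists I : {set G}, independent I && (#|I| == n - l)].
  apply: num_indep_le_big_indep iI sI _ => //; [lia | lia | ].
  apply/negP => bip; move: hchrom; rewrite /k_chromatic /chromatic_number.
  by case: ex_minnP => m _ /(_ _ bip) m_le2 ekm; lia.
apply: num_indep_le_bin_base => //; [lia | lia | ].
move=> S iS; apply: contra none => sS.
by apply/existsP; exists S; rewrite iS.
Qed.
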